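(* Let $U$ be a domain of $\mathbb{R}^2$ and let $f,g$ be smooth functions on $U$. Consider the graph immersion $\boldsymbol{X}:U\to\mathbb{R}^4_1$ given by $\boldsymbol{X}(u_1,u_2)=(f(u_1,u_2),g(u_1,u_2),u_1,u_2)$. Set $$\phi_1=(1-f_{u_2}^2+g_{u_2}^2)f_{u_1u_1}-2(-f_{u_1}f_{u_2}+g_{u_1}g_{u_2})f_{u_1u_2}+(1-f_{u_1}^2+g_{u_1}^2)f_{u_2u_2},$$ $$\phi_2=(1-f_{u_2}^2+g_{u_2}^2)g_{u_1u_1}-2(-f_{u_1}f_{u_2}+g_{u_1}g_{u_2})g_{u_1u_2}+(1-f_{u_1}^2+g_{u_1}^2)g_{u_2u_2},$$ $$\Delta=(f_{u_1}g_{u_1}+f_{u_2}g_{u_2})^2-(1+g_{u_1}^2+g_{u_2}^2)(-1+f_{u_1}^2+f_{u_2}^2).$$ Then $\boldsymbol{X}$ is strongly marginally trapped if and only if $$\Delta>0\quad\text{and}\quad\phi_1=\phi_2=0$$ hold. Moreover, $\boldsymbol{X}$ is marginally trapped if and only if $$\Delta>0\quad\text{and}\quad(1+g_{u_1}^2+g_{u_2}^2)\phi_1^2-2(f_{u_1}g_{u_1}+f_{u_2}g_{u_2})\phi_1\phi_2+(-1+f_{u_1}^2+f_{u_2}^2)\phi_2^2=0.$$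
   Context: $\mathbb{R}^4_1$ is $\mathbb{R}^4$ with the pseudo scalar product $\langle \boldsymbol{x},\boldsymbol{y}\rangle_1=-x_0y_0+x_1y_1+x_2y_2+x_3y_3$. A nonzero vector $\boldsymbol{x}$ is spacelike, timelike or lightlike if $\langle \boldsymbol{x},\boldsymbol{x}\rangle_1$ is $>0$, $<0$ or $=0$ respectively. A surface $\boldsymbol{X}:U\to\mathbb{R}^4_1$ is spacelike if all nonzero tangent vectors are spacelike. Along a spacelike surface let $\boldsymbol{n}^T$ (unit timelike) and $\boldsymbol{n}^S$ (unit spacelike, orthogonal to $\boldsymbol{n}^T$) be an orthonormal frame of the normal bundle, let $\pi^t$ be the orthogonal projection of $T_p\mathbb{R}^4_1$ onto the tangent plane, and set $S_p(\boldsymbol{n}^T)=-\pi^t\circ d_p\boldsymbol{n}^T$, $S_p(\boldsymbol{n}^S)=-\pi^t\circ d_p\boldsymbol{n}^S$. The mean curvature vector is $\mathfrak{H}(p)=\frac12\mathrm{Trace}\,S_p(\boldsymbol{n}^T)\,\boldsymbol{n}^T+\frac12\mathrm{Trace}\,S_p(\boldsymbol{n}^S)\,\boldsymbol{n}^S$. A surface is marginally trapped if it is spacelike and $\mathfrak{H}$ is isotropic (zero or lightlike) at each point; it is strongly marginally trapped if it is spacelike and $\mathfrak{H}=\boldsymbol{0}$ at each point. The conditions on $\Delta,\phi_1,\phi_2$ are required at every point of $U$. *)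

(* Defs.v *)
From HB Require Import structures.
From mathcomp Require Import all_boot all_order all_algebra.
From mathcomp Require Import all_classical all_reals all_analysis.
Set Implicit Arguments.
Unset Strict Implicit.
Unset Printing Implicit Defensive.
Import Order.TTheory GRing.Theory Num.Theory.
Import numFieldNormedType.Exports.
Local Open Scope classical_set_scope.
Local Open Scope ring_scope.

Section Calculus.
Context {R : realType}.
Implicit Types (U : set 'rV[R]_2) (p : 'rV[R]_2).

Definition domain U := [/\ open U, connected U & U !=set0].

(* Class C^k on an open set U: f : 'rV_2 -> V is total, but only its germs at
   the points of U matter. *)
Fixpoint Ck_on (V : normedModType R) (k : nat) U (f : 'rV[R]_2 -> V) : Prop :=
  match k with
  | 0 => forall p, U p -> {for p, continuous f}
  | k'.+1 => (forall p, U p -> differentiable f p) /\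
             (forall v : 'rV[R]_2, Ck_on k' U ('D_v f))
  end.

Definition smooth_on (V : normedModType R) U (f : 'rV[R]_2 -> V) : Prop :=
  forall k, Ck_on k U f.

(* [partial 0] is the derivative in u_1, [partial 1] the one in u_2. *)
Definition partial (i : 'I_2) (f : 'rV[R]_2 -> R) : 'rV[R]_2 -> R :=
  'D_(delta_mx 0 i) f.

End Calculus.

Section MinkowskiSpace.
Context {R : realType}.
Implicit Types (x y w : 'rV[R]_4).

Definition minkowski : 'M[R]_4 := diag_mx (\row_i (if i == 0 then -1 else 1)).

Definition lorentz x y : R := (x *m minkowski *m y^T) 0 0.

Lemma lorentzE x y : lorentz x y =
  - x 0 0 * y 0 0 + x 0 1 * y 0 1 + x 0 2%:R * y 0 2%:R + x 0 3%:R * y 0 3%:R.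
Proof.
rewrite /lorentz mxE !big_ord_recl big_ord0 mul_mx_diag !mxE /= addr0 !addrA.
rewrite mulrN1 !mulr1.
by congr (_ + _ * _ + _ * _ + _ * _); congr fun_of_matrix; apply/val_inj.
Qed.

Definition is_spacelike x := (x != 0) /\ 0 < lorentz x x.
Definition is_lightlike x := (x != 0) /\ lorentz x x = 0.
Definition is_isotropic x := x = 0 \/ is_lightlike x.

End MinkowskiSpace.

Section Surfaces.
Context {R : realType}.
Implicit Types (U : set 'rV[R]_2) (p : 'rV[R]_2).
Implicit Types (X n nT nS : 'rV[R]_2 -> 'rV[R]_4).

(* With the row-vector convention, 'J X p is the 2 x 4 matrix whose rows are
   X_{u_1}(p) and X_{u_2}(p); its row space is the tangent plane at p. *)
Definition tangent_plane X p : 'M[R]_4 := <<'J X p>>%MS.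

(* The w such that <w, X_{u_j}> = 0 for j = 1, 2. *)
Definition normal_plane X p : 'M[R]_4 := kermx (minkowski *m ('J X p)^T).

Definition immersed_surface U X :=
  smooth_on U X /\ forall p, U p -> row_free ('J X p).

Definition spacelike_surface U X :=
  immersed_surface U X /\
  forall p, U p -> forall w : 'rV[R]_4,
    (w <= tangent_plane X p)%MS -> w != 0 -> is_spacelike w.

Definition normal_frame U X nT nS :=
  [/\ smooth_on U nT, smooth_on U nS &
    forall p, U p ->
      [/\ (nT p <= normal_plane X p)%MS, (nS p <= normal_plane X p)%MS,
          lorentz (nT p) (nT p) = -1, lorentz (nS p) (nS p) = 1
        & lorentz (nT p) (nS p) = 0]].

(* pi^t: the projection onto the tangent plane parallel to its orthogonal. *)
Definition tangent_proj X p : 'M[R]_4 :=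
  proj_mx (tangent_plane X p) (normal_plane X p).

(* S_p(n) = - pi^t o d_p n, as a matrix in the basis (X_{u_1}, X_{u_2}) of the
   tangent plane: the i-th row of - 'J n p *m pi^t is the image of X_{u_i}, and
   multiplying by pinvmx ('J X p) takes its coordinates in that basis. *)
Definition shape_operator X n p : 'M[R]_2 :=
  - ('J n p *m tangent_proj X p) *m pinvmx ('J X p).

Definition mean_curvature_vector X nT nS p : 'rV[R]_4 :=
  (2^-1 * \tr (shape_operator X nT p)) *: nT p +
  (2^-1 * \tr (shape_operator X nS p)) *: nS p.

(* The sign of the nT-component makes the mean curvature vector depend on the
   frame, but not whether it vanishes or is isotropic.  The conditions are
   therefore required for every frame; the existence of a frame rules out
   vacuity. *)
Definition mean_curvature_satisfies U X (P : 'rV[R]_4 -> Prop) :=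
  (exists nT nS, normal_frame U X nT nS) /\
  forall nT nS, normal_frame U X nT nS ->
    forall p, U p -> P (mean_curvature_vector X nT nS p).

Definition marginally_trapped U X :=
  spacelike_surface U X /\ mean_curvature_satisfies U X is_isotropic.

Definition strongly_marginally_trapped U X :=
  spacelike_surface U X /\ mean_curvature_satisfies U X (fun h => h = 0).

End Surfaces.

Section Graphs.
Context {R : realType}.
Variables f g : 'rV[R]_2 -> R.

Definition graph (u : 'rV[R]_2) : 'rV[R]_4 :=
  \row_(j < 4) [:: f u; g u; u 0 0; u 0 1]`_j.

Let f1 := partial 0 f.
Let f2 := partial 1 f.
Let g1 := partial 0 g.
Let g2 := partial 1 g.

Definition phi (h : 'rV[R]_2 -> R) (u : 'rV[R]_2) : R :=
  (1 - f2 u ^+ 2 + g2 u ^+ 2) * partial 0 (partial 0 h) u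
  - 2 * (- f1 u * f2 u + g1 u * g2 u) * partial 1 (partial 0 h) u
  + (1 - f1 u ^+ 2 + g1 u ^+ 2) * partial 1 (partial 1 h) u.

Definition phi1 := phi f.
Definition phi2 := phi g.

Definition Delta (u : 'rV[R]_2) : R :=
  (f1 u * g1 u + f2 u * g2 u) ^+ 2
  - (1 + g1 u ^+ 2 + g2 u ^+ 2) * (-1 + f1 u ^+ 2 + f2 u ^+ 2).

Definition trapping_form (u : 'rV[R]_2) : R :=
  (1 + g1 u ^+ 2 + g2 u ^+ 2) * phi1 u ^+ 2
  - 2 * (f1 u * g1 u + f2 u * g2 u) * phi1 u * phi2 u
  + (-1 + f1 u ^+ 2 + f2 u ^+ 2) * phi2 u ^+ 2.

End Graphs.

(* Main.v *)
Require Import Defs.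
From mathcomp Require Import all_boot all_order all_algebra.
From mathcomp Require Import all_classical all_reals all_analysis.
From mathcomp Require Import ring lra.
Local Open Scope classical_set_scope.
Local Open Scope ring_scope.

(** Write f_i, g_i for the first derivatives at a point u.  The normal plane of
    the graph at u is spanned by N1 = (1, 0, f_1, f_2) and
    N2 = (0, 1, -g_1, -g_2), so a normal vector is determined by its first two
    coordinates ([graph_normal]).  The Gram determinant of the tangent basis
    (X_1, X_2) is Delta, that of (N1, N2) is -Delta.  A plane in a space of
    index 1 is never negative definite, so a positive Gram determinant already
    makes the tangent plane spacelike ([graph_tangents_spacelike]).

    The second derivatives of the graph are X_ij = (f_ij, g_ij, 0, 0).
    Differentiating <n, X_j> = 0 for a normal field n gives
    <d_i n, X_j> = - <n, X_ij> ([second_fundamental_form]), and the trace of the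
    shape operator becomes
    Delta * tr S(n) = - n_0 phi1 + n_1 phi2 = <n, V>, where V is the vector
    (phi1, phi2, 0, 0) ([trace_shape_operator]).  In the frame (nT, nS) the mean
    curvature vector H is therefore
    (<nT, V> nT + <nS, V> nS) / (2 Delta).

    The first two coordinates of nT and nS form an invertible matrix, so H = 0
    exactly when phi1 = phi2 = 0.  Further, 4 Delta^2 <H, H> is
    - <nT, V>^2 + <nS, V>^2, the square of the normal part of V; computed in the
    basis (N1, N2) instead of (nT, nS) it is - trapping_form / Delta
    ([frame_gram], [graph_normal_frame_comb]).

    Two analytic facts enter.  The two mixed second derivatives agree
    ([derive_comm]), which turns the trace into phi1 and phi2.  And an
    orthonormal normal frame exists and is smooth ([exists_normal_frame]): it
    comes from (N2, N1) by the Gram-Schmidt process, whose coefficients are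
    built from the f_i and g_i by sums, products and inverse square roots. *)

Set Implicit Arguments.
Unset Strict Implicit.
Unset Printing Implicit Defensive.
Import Order.TTheory GRing.Theory Num.Theory.
Import numFieldNormedType.Exports.

(** * Symmetry of second derivatives *)

Lemma near_eq_differentiable (R : numFieldType) (V W : normedModType R)
    (f g : V -> W) (p : V) :
  (\near p, f p = g p) -> differentiable f p -> differentiable g p.
Proof.
move=> fg /diff_locallyP[dfc dfE].
have gE : g \o shift p = cst (g p) + 'd f p +o_ 0 id.
  apply/eqaddoP => e e0.
  move: dfE => /eqaddoP /(_ e e0) dfE.
  have fg0 : \forall h \near 0, f (h + p) = g (h + p).
    by move: fg; rewrite (near_shift 0) subr0.
  near=> h.
  have -> : (g \o shift p - (cst (g p) + 'd f p)) h =
    (f \o shift p - (cst (f p) + 'd f p)) h.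
    rewrite -[LHS]/(g (h + p) - (g p + 'd f p h)).
    by rewrite -(nbhs_singleton fg) -(near fg0 h).
  by near: h; exact: dfE.
apply/diff_locallyP; have dgE := diff_unique dfc gE.
by split; rewrite dgE.
Unshelve. all: by end_near. Qed.

Lemma is_derive_line (R : numFieldType) (V W : normedModType R) (h : V -> W)
    (p v : V) (s : R) :
  derivable h (p + s *: v) v ->
  is_derive s 1 (fun s => h (p + s *: v)) ('D_v h (p + s *: v)).
Proof.
move=> hd.
have E : (fun k : R => k^-1 *:
      (((fun s => h (p + s *: v)) \o shift s) (k *: (1 : R))
        - h (p + s *: v))) =
   (fun k : R => k^-1 *: ((h \o shift (p + s *: v)) (k *: v) - h (p + s *: v))).
  by apply/funext => k /=; rewrite [_%:A]mulr1 scalerDl addrCA.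
by split; rewrite /derivable /derive E.
Qed.

Lemma subr_exchange (R : realType) (a b c d : R) :
  a - b - (c - d) = a - c - (b - d).
Proof. by rewrite !opprB addrACA [RHS]addrACA [- b - c]addrC. Qed.

Lemma ler_dist_half (R : realType) (e x y z : R) :
  `|x - z| < e / 2 -> `|y - z| < e / 2 -> `|x - y| <= e.
Proof.
move=> xz yz; rewrite (le_trans (ler_distD z _ _))// [e]splitr lerD ?ltW//.
by rewrite distrC.
Qed.

(** The second difference of [h] along [v] and [w] is the increment over [0, t]
    of s |-> h (p + t w + s v) - h (p + s v); the mean value theorem for this
    function, and then for the derivative of [h] along [v], produces a mixed
    derivative at an intermediate point. *)
Lemma mixed_difference (R : realType) (V : normedModType R) (h : V -> R)
    (p v w : V) (t : R) : 0 < t ->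
  (forall a b : R, 0 <= a <= t -> 0 <= b <= t ->
     derivable h (p + a *: v + b *: w) v /\
     derivable ('D_v h) (p + a *: v + b *: w) w) ->
  exists a b, [/\ 0 <= a <= t, 0 <= b <= t &
    h (p + t *: v + t *: w) - h (p + t *: v) - (h (p + t *: w) - h p) =
    'D_w ('D_v h) (p + a *: v + b *: w) * t * t].
Proof.
move=> t0 hd.
pose F s := h (p + t *: w + s *: v) - h (p + s *: v).
have itvP (x : R) : x \in `[0, t] -> 0 <= x <= t by rewrite in_itv.
have itvoP (x : R) : x \in `]0, t[ -> 0 <= x <= t.
  by rewrite in_itv /= => /andP[/ltW-> /ltW->].
have dF (s : R) : 0 <= s <= t -> is_derive s 1 F
    ('D_v h (p + t *: w + s *: v) - 'D_v h (p + s *: v)).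
  move=> s0t; have tt : 0 <= t <= t by rewrite lexx ltW.
  have zt : (0 : R) <= 0 <= t by rewrite lexx ltW.
  apply: is_deriveB; apply: is_derive_line.
    rewrite [p + _ + _]addrAC; exact: (hd s t s0t tt).1.
  by have := (hd s 0 s0t zt).1; rewrite [0 *: w]scale0r addr0.
have cF : {within `[0, t], continuous F}.
  by apply: derivable_within_continuous => x /itvP/dF[].
have [a a0t Fa] := MVT t0 (fun x xt => dF x (itvoP x xt)) cF.
have {}a0t := itvoP _ a0t.
pose G s := 'D_v h (p + a *: v + s *: w).
have dG (s : R) : 0 <= s <= t ->
    is_derive s 1 G ('D_w ('D_v h) (p + a *: v + s *: w)).
  by move=> s0t; apply: is_derive_line; case: (hd a s a0t s0t).
have cG : {within `[0, t], continuous G}.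
  by apply: derivable_within_continuous => x /itvP/dG[].
have [b b0t Gb] := MVT t0 (fun x xt => dG x (itvoP x xt)) cG.
exists a, b; split => //; first exact: itvoP.
move: Fa Gb; rewrite /F /G !scale0r !addr0 !subr0 => Fa Gb.
by rewrite -Gb [p + a *: v + _]addrAC -Fa [p + t *: w + _]addrAC.
Qed.

(** The second difference is symmetric in [v] and [w], so by [mixed_difference]
    both mixed derivatives take a common value at points arbitrarily close to
    [p]; continuity moves this equality to [p]. *)
Lemma derive_comm (R : realType) (V : normedModType R) (U : set V) (h : V -> R)
    (p v w : V) : open U -> U p ->
  (forall q, U q -> [/\ derivable h q v, derivable h q w,
     derivable ('D_v h) q w & derivable ('D_w h) q v]) ->
  {for p, continuous ('D_w ('D_v h))} -> {for p, continuous ('D_v ('D_w h))} ->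
  'D_w ('D_v h) p = 'D_v ('D_w h) p.
Proof.
move=> oU Up hd c1 c2; apply/eqP; rewrite -subr_eq0 -normr_le0.
apply/ler_addgt0Pr => e e0; rewrite add0r.
have e20 : 0 < e / 2 by rewrite divr_gt0.
have nU : \forall q \near p, U q by exact: open_nbhs_nbhs.
move/cvgrPdist_lt : c1 => /(_ _ e20) n1.
move/cvgrPdist_lt : c2 => /(_ _ e20) n2.
have /nbhs_ballP[r /= r0 rP] : nbhs p [set q | [/\ U q,
    `|'D_w ('D_v h) p - 'D_w ('D_v h) q| < e / 2 &
    `|'D_v ('D_w h) p - 'D_v ('D_w h) q| < e / 2]].
  apply: filterS3 nU n1 n2 => q Uq q1 q2.
  split; [exact: Uq | exact: q1 | exact: q2].
(* The step is small enough for the parallelogram spanned by t v and t w to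
   stay in the ball of radius r. *)
pose t := r / 2 / (`|v| + `|w| + 1).
have vw0 : 0 < `|v| + `|w| + 1 by rewrite ltr_wpDl// addr_ge0.
have t0 : 0 < t by rewrite !divr_gt0.
have inball (a b : R) : 0 <= a <= t -> 0 <= b <= t ->
    ball p r (p + a *: v + b *: w).
  move=> /andP[a0 at_] /andP[b0 bt].
  rewrite -ball_normE /= -addrA opprD addrA subrr add0r normrN.
  rewrite (le_lt_trans (ler_normD _ _))// !normrZ !ger0_norm//.
  apply: (@le_lt_trans _ _ (t * `|v| + t * `|w|)).
    by rewrite lerD// ler_wpM2r.
  rewrite -mulrDr /t mulrAC ltr_pdivrMr//.
  apply: (@lt_le_trans _ _ (r * (`|v| + `|w| + 1))) => //.
    have : 0 <= `|v| + `|w| by rewrite addr_ge0.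
    move: (`|v| + `|w|) => x x0; nra.
have [a [b [a0 b0 E1]]] : exists a b, [/\ 0 <= a <= t, 0 <= b <= t &
    h (p + t *: v + t *: w) - h (p + t *: v) - (h (p + t *: w) - h p) =
    'D_w ('D_v h) (p + a *: v + b *: w) * t * t].
  apply: mixed_difference => // a b a0 b0.
  have [/hd[d1 _ d2 _] _ _] := rP _ (inball a b a0 b0).
  by split; [exact: d1|exact: d2].
have [b' [a' [b'0 a'0 E2]]] : exists a b, [/\ 0 <= a <= t, 0 <= b <= t &
    h (p + t *: w + t *: v) - h (p + t *: w) - (h (p + t *: v) - h p) =
    'D_v ('D_w h) (p + a *: w + b *: v) * t * t].
  apply: mixed_difference => // b1 a1 b10 a10; rewrite [p + _ + _]addrAC.
  have [/hd[_ d1 _ d2] _ _] := rP _ (inball a1 b1 a10 b10).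
  by split; [exact: d1|exact: d2].
have [_ B1 _] := rP _ (inball _ _ a0 b0).
have [_ _ B2] := rP _ (inball _ _ a'0 b'0).
move: E2; rewrite [p + b' *: w + _]addrAC [p + t *: w + _]addrAC => E2.
have E : 'D_w ('D_v h) (p + a *: v + b *: w) =
    'D_v ('D_w h) (p + a' *: v + b' *: w).
  have tn0 : t != 0 by rewrite gt_eqF.
  have := subr_exchange (h (p + t *: v + t *: w)) (h (p + t *: v))
    (h (p + t *: w)) (h p).
  by rewrite E1 E2 => /(mulIf tn0)/(mulIf tn0).
by apply: ler_dist_half B1 _; rewrite E.
Qed.

(** * Smooth functions *)

Section Smooth.
Context {R : realType}.
Implicit Types (U : set 'rV[R]_2) (p v : 'rV[R]_2).

Lemma smooth_differentiable (V : normedModType R) U (f : 'rV[R]_2 -> V) p :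
  smooth_on U f -> U p -> differentiable f p.
Proof. by move=> /(_ 1)[+ _]; apply. Qed.

Lemma smooth_continuous (V : normedModType R) U (f : 'rV[R]_2 -> V) p :
  smooth_on U f -> U p -> {for p, continuous f}.
Proof. by move=> /(_ 0); apply. Qed.

Lemma smooth_derive (V : normedModType R) U (f : 'rV[R]_2 -> V) v :
  smooth_on U f -> smooth_on U ('D_v f).
Proof. by move=> sf k; have [_] := sf k.+1; apply. Qed.

Lemma open_near_eq (V : Type) U (f g : 'rV[R]_2 -> V) p :
  open U -> (forall q, U q -> f q = g q) -> U p -> \near p, f p = g p.
Proof.
by move=> oU fg Up; apply: filterS (open_nbhs_nbhs (conj oU Up)) => q /fg.
Qed.

Lemma eq_Ck_on (V : normedModType R) U k (f g : 'rV[R]_2 -> V) :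
  open U -> (forall p, U p -> f p = g p) -> Ck_on k U f -> Ck_on k U g.
Proof.
move=> oU; elim: k f g => [|k IH] f g fg /=.
  move=> cf p Up; have fgp := open_near_eq oU fg Up.
  have : f @ p --> f p := cf p Up.
  rewrite (fg p Up) => fp; apply: cvg_trans fp.
  exact: (near_eq_cvg fgp).
move=> [df Df]; split=> [p Up|v].
  exact: near_eq_differentiable (open_near_eq oU fg Up) (df p Up).
apply: IH (Df v) => p Up; exact: near_eq_derive (open_near_eq oU fg Up).
Qed.

(** Smoothness of a whole class of functions at once: if the class consists of
    differentiable functions and is stable under directional derivatives, up to
    values outside [U], then induction on the order of differentiability covers
    all its members simultaneously. *)
Lemma smooth_coind (V : normedModType R) U (S : ('rV[R]_2 -> V) -> Prop) :
  open U ->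
  (forall f, S f -> (forall p, U p -> differentiable f p) /\
     forall v, exists2 g, S g & forall p, U p -> 'D_v f p = g p) ->
  forall f, S f -> smooth_on U f.
Proof.
move=> oU SD f Sf k; elim: k f Sf => [|k IH] f /SD[df Df] /=.
  by move=> p Up; apply/differentiable_continuous/df.
split=> // v; have [g /IH Sg fg] := Df v.
by apply: eq_Ck_on Sg => // p Up; rewrite fg.
Qed.

(** A class stable under directional derivatives in the sense of
    [smooth_coind]: the derivative of a product or of an inverse square root is
    again a sum of products of members.  Inverse square roots are the only
    non-polynomial operation in the Gram-Schmidt process. *)
Inductive smooth_expr U : ('rV[R]_2 -> R) -> Prop :=
| SmoothAtom f : smooth_on U f -> smooth_expr U f
| SmoothCst c : smooth_expr U (cst c)
| SmoothCoord i : smooth_expr U (fun p => p 0 i)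
| SmoothAdd f g : smooth_expr U f -> smooth_expr U g -> smooth_expr U (f + g)
| SmoothMul f g : smooth_expr U f -> smooth_expr U g -> smooth_expr U (f * g)
| SmoothRsqrt f : (forall p, U p -> 0 < f p) -> smooth_expr U f ->
    smooth_expr U (fun p => (Num.sqrt (f p))^-1).

(** The derivative is grouped as a product of members of [smooth_expr]. *)
Lemma derive_rsqrt (f : 'rV[R]_2 -> R) p v :
  0 < f p -> differentiable f p ->
  differentiable (fun p => (Num.sqrt (f p))^-1) p /\
  'D_v (fun p => (Num.sqrt (f p))^-1) p =
  - 2^-1 * ((Num.sqrt (f p))^-1 * ((Num.sqrt (f p))^-1 *
    ((Num.sqrt (f p))^-1 * 'D_v f p))).
Proof.
move=> fp0 df; have s0 : Num.sqrt (f p) != 0 by rewrite gt_eqF// sqrtr_gt0.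
pose phi (y : R) := (Num.sqrt y)^-1.
have [ds Ds] := is_derive1_sqrt fp0.
have dphi : differentiable phi (f p).
  apply: differentiableV s0; exact/derivable1_diffP.
have Dphi : 'D_1 phi (f p) = - (Num.sqrt (f p)) ^- 2 * (2 * Num.sqrt (f p))^-1.
  by rewrite /phi (deriveV s0 ds) Ds.
have dc : differentiable (phi \o f) p := differentiable_comp df dphi.
split; first exact: dc.
have -> : 'D_v (phi \o f) p = 'D_v f p * 'D_1 phi (f p).
  rewrite (deriveE v dc) (diff_comp df dphi) /= -(deriveE v df).
  rewrite (deriveE (1 : R) dphi).
  by rewrite -[X in 'd _ _ X]mulr1 [LHS]linearZ.
by rewrite Dphi; field.
Qed.

Lemma derive_coord p v i : 'D_v (fun q : 'rV[R]_2 => q 0 i) p = v 0 i.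
Proof.
have did : derivable (id : 'rV[R]_2 -> 'rV[R]_2) p v by exact: derivable_id.
by have := derive_mx did; rewrite derive_id => /matrixP/(_ 0 i); rewrite mxE.
Qed.

Lemma smooth_expr_derive U f : open U -> smooth_expr U f ->
  (forall p, U p -> differentiable f p) /\
  forall v, exists2 g, smooth_expr U g & forall p, U p -> 'D_v f p = g p.
Proof.
move=> oU; elim=> {f}.
- move=> f sf; split=> [p Up|v]; first exact: smooth_differentiable sf Up.
  by exists ('D_v f) => //; apply/SmoothAtom/smooth_derive.
- move=> c; split=> [p _|v]; first exact: differentiable_cst.
  by exists (cst 0) => [|p _]; [exact: SmoothCst | exact: derive_cst].
- move=> i; split=> [p _|v]; first exact: differentiable_coord.
  by exists (cst (v 0 i)) => [|p _]; [exact: SmoothCst | exact: derive_coord].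
- move=> f g sf [df Df] sg [dg Dg]; split=> [p Up|v].
    by apply: differentiableD; [exact: df|exact: dg].
  have [f' sf' ff'] := Df v; have [g' sg' gg'] := Dg v.
  exists (f' + g') => [|p Up]; first exact: SmoothAdd.
  rewrite deriveD ?ff' ?gg'//; apply: diff_derivable; [exact: df|exact: dg].
- move=> f g sf [df Df] sg [dg Dg]; split=> [p Up|v].
    by apply: differentiableM; [exact: df|exact: dg].
  have [f' sf' ff'] := Df v; have [g' sg' gg'] := Dg v.
  exists (f * g' + g * f') => [|p Up].
    by apply: SmoothAdd; exact: SmoothMul.
  rewrite deriveM ?ff' ?gg'//; apply: diff_derivable; [exact: df|exact: dg].
- move=> f f0 sf [df Df]; split=> [p Up|v].
    exact: (derive_rsqrt 0 (f0 p Up) (df p Up)).1.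
  have [f' sf' ff'] := Df v; pose r p := (Num.sqrt (f p))^-1.
  have sr : smooth_expr U r by exact: SmoothRsqrt.
  exists (cst (- 2^-1) * (r * (r * (r * f')))) => [|p Up].
    apply: SmoothMul; first exact: SmoothCst.
    exact: (SmoothMul sr (SmoothMul sr (SmoothMul sr sf'))).
  by rewrite (derive_rsqrt v (f0 p Up) (df p Up)).2 ff'.
Qed.

Lemma smooth_expr_smooth U f : open U -> smooth_expr U f -> smooth_on U f.
Proof.
move=> oU; apply: smooth_coind => // g; exact: smooth_expr_derive.
Qed.

Lemma rV_sum_delta n (F : 'rV[R]_2 -> 'rV[R]_n) :
  F = \sum_j (fun p => F p 0 j *: delta_mx 0 j).
Proof.
apply/funext => p; rewrite fct_sumE; exact: row_sum_delta.
Qed.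

Lemma smooth_on_rV n U (F : 'rV[R]_2 -> 'rV[R]_n) : open U ->
  (forall j, smooth_on U (fun p => F p 0 j)) -> smooth_on U F.
Proof.
move=> oU sF.
pose S (F : 'rV[R]_2 -> 'rV[R]_n) := forall j, smooth_on U (fun p => F p 0 j).
suff SD : forall F, S F -> (forall p, U p -> differentiable F p) /\
    forall v, exists2 G, S G & forall p, U p -> 'D_v F p = G p.
  exact: (smooth_coind oU SD sF).
move=> {sF}F sF.
have dF p : U p -> differentiable F p.
  move=> Up; rewrite [F]rV_sum_delta; apply: differentiable_sum => j.
  exact/differentiableZl/(smooth_differentiable (sF j)).
split=> // v; exists (fun p => \row_j 'D_v (fun q => F q 0 j) p) => [j|p Up].
  have -> : (fun p => (\row_j 'D_v (fun q => F q 0 j) p) 0 j) =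
    'D_v (fun q => F q 0 j) by apply/funext => p; rewrite mxE.
  exact: smooth_derive.
rewrite derive_mx; last exact/diff_derivable/dF.
by apply/rowP => j; rewrite !mxE.
Qed.

End Smooth.

(** * Linear algebra of the tangent and normal planes of a graph *)

Lemma sum_ord2 (V : nmodType) (F : 'I_2 -> V) : \sum_i F i = F 0 + F 1.
Proof. by rewrite big_ord_recl big_ord1; congr (_ + F _); apply/val_inj. Qed.

Lemma ord2P (i : 'I_2) : i = 0 \/ i = 1.
Proof. by case: i => [[|[|//]] ilt]; [left|right]; apply/val_inj. Qed.

Lemma eq_rV2 (T : Type) (v w : 'rV[T]_2) :
  v 0 0 = w 0 0 -> v 0 1 = w 0 1 -> v = w.
Proof. by move=> e0 e1; apply/rowP => i; have [->|->] := ord2P i. Qed.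

Lemma ord4P (i : 'I_4) : [\/ i = 0, i = 1, i = 2%:R | i = 3%:R].
Proof.
by case: i => [[|[|[|[|//]]]] ilt];
  [constructor 1|constructor 2|constructor 3|constructor 4]; apply/val_inj.
Qed.

Lemma det_mx22 (F : comNzRingType) (A : 'M[F]_2) :
  \det A = A 0 0 * A 1 1 - A 0 1 * A 1 0.
Proof.
rewrite (expand_det_row _ 0) sum_ord2 /cofactor !det_mx11 !mxE /= expr0 expr1.
rewrite mul1r mulN1r mulrN.
by congr (_ * A _ _ - _ * A _ _); apply/val_inj.
Qed.

Section GraphPlanes.
Context {R : realType}.
Implicit Types (a b : 'I_2 -> R) (x y : R).

(** The rows X_0, X_1 are the derivatives of the graph when [a] and [b] are the
    gradients of f and g; the indices 0 and 1 stand for u_1 and u_2. *)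
Definition graph_tangents a b : 'M[R]_(2, 4) :=
  \matrix_(i, j) [:: a i; b i; (i == 0)%:R; (i == 1)%:R]`_j.

(** The combination of (1, 0, a_0, a_1) and (0, 1, - b_0, - b_1) with
    coefficients x and y. *)
Definition graph_normal a b x y : 'rV[R]_4 :=
  \row_j [:: x; y; x * a 0 - y * b 0; x * a 1 - y * b 1]`_j.

Lemma mul_minkowski_tr m n (A : 'M[R]_(m, 4)) (B : 'M[R]_(n, 4)) i j :
  (A *m Defs.minkowski *m B^T) i j = lorentz (row i A) (row j B).
Proof.
rewrite /lorentz -row_mul !mxE; apply: eq_bigr => k _; rewrite [in RHS]mxE.
by rewrite !mxE.
Qed.

Lemma gram_graph_tangents a b i j :
  lorentz (row i (graph_tangents a b)) (row j (graph_tangents a b)) =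
  (i == j)%:R - a i * a j + b i * b j.
Proof.
rewrite lorentzE !mxE /=.
by have [->|->] := ord2P i; have [->|->] := ord2P j; rewrite /=; ring.
Qed.

Lemma lorentz_graph_tangents a b (w : 'rV[R]_4) i :
  lorentz w (row i (graph_tangents a b)) =
  - w 0 0 * a i + w 0 1 * b i + w 0 (if i == 0 then 2%:R else 3%:R).
Proof.
rewrite lorentzE !mxE /=.
by have [->|->] := ord2P i; rewrite /=; ring.
Qed.

Lemma sub_normal_graph a b (w : 'rV[R]_4) :
  (w <= kermx (Defs.minkowski *m (graph_tangents a b)^T))%MS <->
  w = graph_normal a b (w 0 0) (w 0 1).
Proof.
split.
  move=> /sub_kermxP; rewrite mulmxA => w0.
  have wi i : - w 0 0 * a i + w 0 1 * b i +
      w 0 (if i == 0 then 2%:R else 3%:R) = 0.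
    by rewrite -lorentz_graph_tangents -[w](row_id 0) -mul_minkowski_tr w0 mxE.
  apply/rowP => j; rewrite mxE.
  have [w2 w3] := (wi 0, wi 1).
  move: w2 w3 => /= w2 w3.
  by have [->|->|->|->] := ord4P j => //=; lra.
move=> wE; apply/sub_kermxP; rewrite mulmxA; apply/matrixP => i j.
rewrite mul_minkowski_tr row_id ord1 lorentz_graph_tangents wE !mxE /=.
by have [->|->] := ord2P j; rewrite /=; ring.
Qed.

Lemma lorentz_graph_normal a b x y x' y' :
  lorentz (graph_normal a b x y) (graph_normal a b x' y') =
  (-1 + a 0 ^+ 2 + a 1 ^+ 2) * x * x'
  - (a 0 * b 0 + a 1 * b 1) * (x * y' + y * x')
  + (1 + b 0 ^+ 2 + b 1 ^+ 2) * y * y'.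
Proof. by rewrite lorentzE !mxE /=; ring. Qed.

Lemma mul_graph_tangents a b (v : 'rV[R]_2) : v *m graph_tangents a b =
  \row_j [:: v 0 0 * a 0 + v 0 1 * a 1; v 0 0 * b 0 + v 0 1 * b 1;
    v 0 0; v 0 1]`_j.
Proof.
apply/rowP => j; rewrite !mxE sum_ord2 !mxE.
by have [->|->|->|->] := ord4P j; rewrite /=; ring.
Qed.

Lemma graph_tangents_free a b : row_free (graph_tangents a b).
Proof.
apply: inj_row_free => v; rewrite mul_graph_tangents => /rowP v0.
have := v0 2%:R; have := v0 3%:R; rewrite !mxE /= => w3 w2.
by apply: eq_rV2; rewrite !mxE.
Qed.

(** Delta as a function of the gradients. *)
Definition graph_disc a b : R :=
  (a 0 * b 0 + a 1 * b 1) ^+ 2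
  - (1 + b 0 ^+ 2 + b 1 ^+ 2) * (-1 + a 0 ^+ 2 + a 1 ^+ 2).

(** Both sides say that the first fundamental form, with coefficients E, F, G,
    is positive definite.  That Delta > 0 forces E > 0 is where the signature enters: the
    tangent vector a_1 X_0 - a_0 X_1 has no time component, so the form is
    nonnegative on it.  This excludes a negative definite form unless
    a_0 = a_1 = 0, and then E = 1 + b_0^2. *)
Lemma graph_tangents_spacelike a b :
  (forall w : 'rV[R]_4, (w <= <<graph_tangents a b>>)%MS ->
    w != 0 -> is_spacelike w)
  <-> 0 < graph_disc a b.
Proof.
pose E := 1 - a 0 ^+ 2 + b 0 ^+ 2; pose F := - a 0 * a 1 + b 0 * b 1.
pose G := 1 - a 1 ^+ 2 + b 1 ^+ 2.
have DE : graph_disc a b = E * G - F ^+ 2 by rewrite /graph_disc /E /F /G; ring.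
have lE (v : 'rV[R]_2) :
  lorentz (v *m graph_tangents a b) (v *m graph_tangents a b)
   = E * v 0 0 ^+ 2 + 2 * F * v 0 0 * v 0 1 + G * v 0 1 ^+ 2.
  by rewrite mul_graph_tangents lorentzE !mxE /= /E /F /G; ring.
split=> [sp|D0 w].
  have pos (x y : R) : (x != 0) || (y != 0) ->
      0 < E * x ^+ 2 + 2 * F * x * y + G * y ^+ 2.
    move=> xy; pose v : 'rV[R]_2 := \row_i [:: x; y]`_i.
    have := lE v; rewrite !mxE /= => <-.
    apply: (sp _ _ _).2; first by rewrite genmxE submxMl.
    apply: contraTneq xy => v0.
    have /eqP : v = 0.
      by apply: (row_free_inj (graph_tangents_free a b)); rewrite v0 mul0mx.
    move=> /eqP/rowP v00; have := v00 0; have := v00 1.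
    rewrite !mxE /= => -> ->.
    by rewrite eqxx.
  have E0 : 0 < E.
    have := pos 1 0; rewrite oner_eq0 => /(_ isT).
    by rewrite expr0n !mulr0 !addr0 expr1n mulr1.
  have := pos (- F) E; rewrite (gt_eqF E0) orbT => /(_ isT).
  have -> : E * (- F) ^+ 2 + 2 * F * - F * E + G * E ^+ 2 =
      E * (E * G - F ^+ 2) by ring.
  by rewrite DE pmulr_rgt0.
have E0 : 0 < E.
  rewrite ltNge; apply/negP => E0.
  pose Q := a 0 ^+ 2 + a 1 ^+ 2 + (a 1 * b 0 - a 0 * b 1) ^+ 2.
  have EQ : E * Q = (E * a 1 - F * a 0) ^+ 2 + graph_disc a b * a 0 ^+ 2.
    by rewrite DE /E /F /G /Q; ring.
  have EQ0 : 0 <= E * Q.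
    by rewrite EQ addr_ge0 ?sqr_ge0// mulr_ge0 ?sqr_ge0// ltW.
  have a0Q : a 0 ^+ 2 <= Q by rewrite /Q -addrA lerDl addr_ge0 ?sqr_ge0.
  have E1 : E != 0.
    apply: contraTneq D0 => E1.
    by rewrite DE E1 mul0r add0r -leNgt oppr_le0 sqr_ge0.
  have Q0 : Q <= 0 by rewrite -(nmulr_rge0 _ (_ : E < 0))// lt_neqAle E1.
  have : 1 <= E + a 0 ^+ 2 by rewrite /E addrAC subrK lerDl sqr_ge0.
  by apply/negP; rewrite -ltNge; lra.
rewrite genmxE => /submxP[v ->] vJ0; split => //; rewrite lE.
rewrite -(pmulr_rgt0 _ E0).
have -> : E * (E * v 0 0 ^+ 2 + 2 * F * v 0 0 * v 0 1 + G * v 0 1 ^+ 2) =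
  (E * v 0 0 + F * v 0 1) ^+ 2 + graph_disc a b * v 0 1 ^+ 2.
  by rewrite DE; ring.
have [v1|v1] := eqVneq (v 0 1) 0; last first.
  by rewrite ltr_wpDl ?sqr_ge0// mulr_gt0// exprn_even_gt0.
rewrite v1 mulr0 addr0 expr0n mulr0 addr0.
rewrite exprn_even_gt0//= mulf_neq0 ?(gt_eqF E0)//.
apply: contraNneq vJ0 => v0; rewrite (_ : v = 0) ?mul0mx//.
by apply: eq_rV2; rewrite mxE.
Qed.

(** Let K be the symmetric matrix with entries al, - be, ga and P the matrix
    with rows (a0, a1), (b0, b1).  The hypotheses say that P K P^T is
    diag (-1, 1), whence (det P)^2 det K = -1 and P^T diag (-1, 1) P is the
    inverse of K.  The second conclusion evaluates the latter form at (- p, q),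
    with 1 / det K written as - (det P)^2. *)
Lemma frame_gram (al be ga a0 a1 b0 b1 p q : R) :
  al * a0 * a0 - be * (a0 * a1 + a1 * a0) + ga * a1 * a1 = -1 ->
  al * b0 * b0 - be * (b0 * b1 + b1 * b0) + ga * b1 * b1 = 1 ->
  al * a0 * b0 - be * (a0 * b1 + a1 * b0) + ga * a1 * b1 = 0 ->
  (a0 * b1 - a1 * b0) ^+ 2 * (be ^+ 2 - ga * al) = 1 /\
  - (- a0 * p + a1 * q) ^+ 2 + (- b0 * p + b1 * q) ^+ 2 =
  - (a0 * b1 - a1 * b0) ^+ 2 *
    (ga * p ^+ 2 - 2 * be * p * q + al * q ^+ 2).
Proof.
set Qa := (X in X = -1 -> _); set Qb := (X in _ -> X = 1 -> _).
set Qab := (X in _ -> _ -> X = 0 -> _) => Qa1 Qb1 Qab0.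
(* The entries of P^T diag (-1, 1) P come from evaluating the form K on
   a0 b - b0 a = (0, d) and a1 b - b1 a = (- d, 0). *)
set d := a0 * b1 - a1 * b0.
have e1 : Qa * Qb - Qab ^+ 2 = - d ^+ 2 * (be ^+ 2 - ga * al).
  by rewrite /Qa /Qb /Qab /d; ring.
have e2 : a0 ^+ 2 * Qb - 2 * a0 * b0 * Qab + b0 ^+ 2 * Qa = d ^+ 2 * ga.
  by rewrite /Qa /Qb /Qab /d; ring.
have e3 : a1 ^+ 2 * Qb - 2 * a1 * b1 * Qab + b1 ^+ 2 * Qa = d ^+ 2 * al.
  by rewrite /Qa /Qb /Qab /d; ring.
have e4 : a0 * a1 * Qb - (a0 * b1 + a1 * b0) * Qab + b0 * b1 * Qa = d ^+ 2 * be.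
  by rewrite /Qa /Qb /Qab /d; ring.
move: e1 e2 e3 e4; rewrite Qa1 Qb1 Qab0 => e1 e2 e3 e4.
split; first by lra.
have -> : - d ^+ 2 * (ga * p ^+ 2 - 2 * be * p * q + al * q ^+ 2) =
  - (d ^+ 2 * ga) * p ^+ 2 + 2 * (d ^+ 2 * be) * p * q - (d ^+ 2 * al) * q ^+ 2.
  by ring.
by rewrite -e2 -e3 -e4; ring.
Qed.

(** Orthonormalisation of (N2, N1) with Gram entries [ga], [- be], [al]: the
    spacelike vector is r N2 and the timelike one s (N1 + r^2 be N2). *)
Lemma gram_schmidt_coeffs (al be ga r s : R) :
  ga != 0 -> be ^+ 2 - ga * al != 0 ->
  r * r = ga^-1 -> s * s = ((be ^+ 2 - ga * al) / ga)^-1 ->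
  let t := s * (r * (r * be)) in
  [/\ al * s * s - be * (s * t + t * s) + ga * t * t = -1,
      al * 0 * 0 - be * (0 * r + r * 0) + ga * r * r = 1
    & al * s * 0 - be * (s * r + t * 0) + ga * t * r = 0].
Proof.
move=> ga0 D0 rr ss t; split.
- transitivity (s * s *
    (al - 2 * (r * r) * be ^+ 2 + ga * (r * r) ^+ 2 * be ^+ 2)).
    by rewrite /t; ring.
  by rewrite ss rr; field; rewrite ga0 D0.
- by rewrite !mul0r !mulr0 addr0 mulr0 subr0 add0r -mulrA rr divff.
- transitivity (s * r * be * (ga * (r * r) - 1)); first by rewrite /t; ring.
  by rewrite rr divff// subrr mulr0.
Qed.

(** With G the Gram matrix of the rows of [J], the shape operator S satisfies
    S G = - D M J^T, where M is the matrix of the Minkowski product, since the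
    part of [D] removed by the projection is orthogonal to the rows of [J].  The
    formula is det G * tr S = tr (S G adj G). *)
Lemma shape_trace (J D : 'M[R]_(2, 4)) :
  let G i j := lorentz (row i J) (row j J) in
  let K i j := - lorentz (row i D) (row j J) in
  G 0 0 * G 1 1 - G 0 1 ^+ 2 != 0 ->
  (G 0 0 * G 1 1 - G 0 1 ^+ 2) *
  \tr (- (D *m proj_mx <<J>>%MS (kermx (Defs.minkowski *m J^T))) *m pinvmx J) =
  K 0 0 * G 1 1 - (K 0 1 + K 1 0) * G 0 1 + K 1 1 * G 0 0.
Proof.
move=> G K det0.
pose N := kermx (Defs.minkowski *m J^T); pose g := J *m Defs.minkowski *m J^T.
have gE i j : g i j = G i j by rewrite /g mul_minkowski_tr.
have GC i j : G i j = G j i by rewrite /G !lorentzE; ring.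
have gU : g \in unitmx.
  by rewrite unitmxE unitfE det_mx22 !gE (GC 1 0) -expr2.
(* The orthogonal projection onto the rows of J exists as G is invertible. *)
have full : (1%:M <= <<J>> + N)%MS.
  pose P := Defs.minkowski *m J^T *m invmx g *m J.
  rewrite -[1%:M](subrK P) addrC addmx_sub_adds//.
    by rewrite genmxE /P submxMl.
  apply/sub_kermxP; rewrite mulmxBl mul1mx /P.
  by rewrite -!mulmxA [J *m _]mulmxA -/g mulVmx// mulmx1 subrr.
set Q := D *m _; set S := _ *m pinvmx J.
have SgK : S *m g = - (D *m Defs.minkowski *m J^T).
  have QJ : Q *m pinvmx J *m J = Q.
    by rewrite mulmxKpV// -(genmxE J) proj_mx_sub.
  have QN : (D - Q <= N)%MS.
    by apply: proj_mx_compl_sub; apply: submx_trans full; exact: submx1.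
  rewrite /S /g mulmxA mulmxA !mulNmx QJ; congr (- _).
  apply/esym/eqP; rewrite -subr_eq0 -!mulmxBl -mulmxA.
  by apply/eqP/sub_kermxP.
have s i j : S i 0 * G 0 j + S i 1 * G 1 j = K i j.
  have -> : K i j = (- (D *m Defs.minkowski *m J^T)) i j.
    by rewrite mxE mul_minkowski_tr.
  by rewrite -SgK [RHS]mxE sum_ord2 !gE.
rewrite /mxtrace sum_ord2.
have [s00 s01] := (s 0 0, s 0 1); have [s10 s11] := (s 1 0, s 1 1).
rewrite -s00 -s01 -s10 -s11 (GC 1 0); ring.
Qed.

(** The trace of det G * h * G^-1 for a symmetric bilinear form [h] and the Gram
    matrix G of the tangent basis; for [h] a Hessian this is the expression
    defining phi1 and phi2. *)
Definition graph_trace a b (h : 'I_2 -> 'I_2 -> R) : R :=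
  (1 - a 1 ^+ 2 + b 1 ^+ 2) * h 0 0 - 2 * (- a 0 * a 1 + b 0 * b 1) * h 1 0
  + (1 - a 0 ^+ 2 + b 0 ^+ 2) * h 1 1.

Lemma shape_trace_graph a b (D : 'M[R]_(2, 4)) x y (hf hg : 'I_2 -> 'I_2 -> R) :
  let J := graph_tangents a b in
  (forall i j, lorentz (row i D) (row j J) = x * hf i j - y * hg i j) ->
  hf 0 1 = hf 1 0 -> hg 0 1 = hg 1 0 -> 0 < graph_disc a b ->
  graph_disc a b *
  \tr (- (D *m proj_mx <<J>>%MS (kermx (Defs.minkowski *m J^T))) *m pinvmx J) =
  - x * graph_trace a b hf + y * graph_trace a b hg.
Proof.
move=> J DJ hfC hgC D0; have := @shape_trace J D.
rewrite /= !gram_graph_tangents !DJ hfC hgC /=; set t := \tr _.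
have -> : (1 - a 0 * a 0 + b 0 * b 0) * (1 - a 1 * a 1 + b 1 * b 1) -
    (0 - a 0 * a 1 + b 0 * b 1) ^+ 2 = graph_disc a b.
  by rewrite /graph_disc; ring.
move=> ->; last by rewrite gt_eqF.
by rewrite /graph_trace; ring.
Qed.

Lemma lorentz_comb (c e : R) (a b : 'rV[R]_4) :
  lorentz (c *: a + e *: b) (c *: a + e *: b) =
  c ^+ 2 * lorentz a a + 2 * c * e * lorentz a b + e ^+ 2 * lorentz b b.
Proof. by rewrite !lorentzE !mxE; ring. Qed.

Lemma lorentz_combl (c e : R) (a b w : 'rV[R]_4) :
  lorentz (c *: a + e *: b) w = c * lorentz a w + e * lorentz b w.
Proof. by rewrite !lorentzE !mxE; ring. Qed.

Lemma lorentzC (a b : 'rV[R]_4) : lorentz a b = lorentz b a.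
Proof. by rewrite !lorentzE; ring. Qed.

Lemma isotropicP (h : 'rV[R]_4) : is_isotropic h <-> lorentz h h = 0.
Proof.
split=> [[->|[]//]|h0]; first by rewrite /lorentz !mul0mx mxE.
by have [->|hn0] := eqVneq h 0; [left|right; split].
Qed.

(** The hypotheses on [tT] and [tS] are the trace formulas for the two shape
    operators, so [H] is the mean curvature vector.  Both equivalences follow
    from [frame_gram]: its first conclusion makes the coordinate matrix of the
    frame invertible, and its second one evaluates 4 Delta^2 <H, H>. *)
Lemma graph_normal_frame_comb a b (nT nS : 'rV[R]_4) (tT tS p q : R) :
  nT = graph_normal a b (nT 0 0) (nT 0 1) ->
  nS = graph_normal a b (nS 0 0) (nS 0 1) ->
  lorentz nT nT = -1 -> lorentz nS nS = 1 -> lorentz nT nS = 0 ->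
  graph_disc a b * tT = - nT 0 0 * p + nT 0 1 * q ->
  graph_disc a b * tS = - nS 0 0 * p + nS 0 1 * q ->
  let H := (2^-1 * tT) *: nT + (2^-1 * tS) *: nS in
  (H = 0 <-> p = 0 /\ q = 0) /\
  (is_isotropic H <->
    (1 + b 0 ^+ 2 + b 1 ^+ 2) * p ^+ 2 - 2 * (a 0 * b 0 + a 1 * b 1) * p * q
    + (-1 + a 0 ^+ 2 + a 1 ^+ 2) * q ^+ 2 = 0).
Proof.
move=> nTE nSE TT SS TS trT trS H.
have Q1 := TT; rewrite nTE lorentz_graph_normal in Q1.
have Q2 := SS; rewrite nSE lorentz_graph_normal in Q2.
have Q3 := TS; rewrite nTE nSE lorentz_graph_normal in Q3.
have [dD form] := frame_gram p q Q1 Q2 Q3.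
rewrite -trT -trS in form.
rewrite -/(graph_disc a b) in dD.
move: (graph_disc a b) => D in trT trS dD form.
set T := (X in _ <-> X = 0); rewrite -/T in form.
set d := nT 0 0 * nS 0 1 - nT 0 1 * nS 0 0 in dD form.
have d0 : d != 0.
  by apply: contra_eq_neq dD => ->; rewrite expr0n mul0r eq_sym oner_eq0.
have D0 : D != 0.
  by apply: contra_eq_neq dD => ->; rewrite mulr0 eq_sym oner_eq0.
have HH : lorentz H H = 4^-1 * (- tT ^+ 2 + tS ^+ 2).
  by rewrite lorentz_comb TT SS TS; field.
split; first split=> [H0|[p0 q0]].
- have h0 w : lorentz H w = 0 by rewrite H0 /lorentz !mul0mx mxE.
  have HT : lorentz H nT = - (2^-1 * tT).
    by rewrite lorentz_combl TT [lorentz nS _]lorentzC TS; ring.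
  have HS : lorentz H nS = 2^-1 * tS by rewrite lorentz_combl TS SS; ring.
  have tT0 : tT = 0 by move: HT; rewrite h0; lra.
  have tS0 : tS = 0 by move: HS; rewrite h0; lra.
  rewrite tT0 mulr0 in trT; rewrite tS0 mulr0 in trS.
  split; apply: (mulfI d0); rewrite mulr0.
  + have -> : d * p = nT 0 1 * (- nS 0 0 * p + nS 0 1 * q)
      - nS 0 1 * (- nT 0 0 * p + nT 0 1 * q) by rewrite /d; ring.
    by rewrite -trT -trS !mulr0 subrr.
  + have -> : d * q = nT 0 0 * (- nS 0 0 * p + nS 0 1 * q)
      - nS 0 0 * (- nT 0 0 * p + nT 0 1 * q) by rewrite /d; ring.
    by rewrite -trT -trS !mulr0 subrr.
- have tT0 : tT = 0 by apply: (mulfI D0); rewrite trT p0 q0 !mulr0 addr0.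
  have tS0 : tS = 0 by apply: (mulfI D0); rewrite trS p0 q0 !mulr0 addr0.
  by rewrite /H tT0 tS0 !mulr0 !scale0r addr0.
have TE : T = - 4 * D ^+ 2 / d ^+ 2 * lorentz H H.
  apply: (mulfI (_ : - d ^+ 2 != 0)); first by rewrite oppr_eq0 expf_neq0.
  by rewrite -form HH; field.
rewrite isotropicP; split=> [H0|T0]; first by rewrite TE H0 mulr0.
move/eqP: TE; rewrite T0 eq_sym mulf_eq0 => /orP[|/eqP//].
by rewrite mulf_eq0 invr_eq0 !expf_eq0 /= (negbTE d0) orbF mulf_eq0 expf_eq0
  (negbTE D0) orbF oppr_eq0 pnatr_eq0.
Qed.

End GraphPlanes.

(** * The mean curvature of a graph *)

Section GraphGeometry.
Context {R : realType}.
Implicit Types (U : set 'rV[R]_2) (u : 'rV[R]_2) (f g : 'rV[R]_2 -> R).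

Definition grad f u : 'I_2 -> R := fun i => partial i f u.

Lemma graph_coord f g :
  [/\ (fun q => graph f g q 0 0) = f, (fun q => graph f g q 0 1) = g,
      (fun q => graph f g q 0 2%:R) = (fun q => q 0 0)
    & (fun q => graph f g q 0 3%:R) = (fun q => q 0 1)].
Proof. by split; apply/funext => q; rewrite mxE. Qed.

Lemma smooth_graph U f g : open U -> smooth_on U f -> smooth_on U g ->
  smooth_on U (graph f g).
Proof.
move=> oU sf sg; apply: smooth_on_rV => // j.
have [c0 c1 c2 c3] := graph_coord f g.
have sc k : smooth_on U (fun q : 'rV[R]_2 => q 0 k).
  exact/smooth_expr_smooth/SmoothCoord.
by have [->|->|->|->] := ord4P j; rewrite ?c0 ?c1 ?c2 ?c3.
Qed.

Lemma jacobianE n (F : 'rV[R]_2 -> 'rV[R]_n) u i j : differentiable F u ->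
  'J F u i j = partial i (fun q => F q 0 j) u.
Proof.
move=> dF; have -> : 'J F u i j = ('D_(delta_mx 0 i) F u) 0 j.
  by rewrite deriveEjacobian// -rowE [RHS]mxE.
by rewrite derive_mx ?mxE//; exact: diff_derivable.
Qed.

Lemma partial_coord i k u : partial i (fun q => q 0 k) u = (i == k)%:R.
Proof. by rewrite /partial derive_coord mxE eqxx eq_sym. Qed.

Lemma jacobian_graph U f g u :
  open U -> smooth_on U f -> smooth_on U g -> U u ->
  'J (graph f g) u = graph_tangents (grad f u) (grad g u).
Proof.
move=> oU sf sg Uu; apply/matrixP => i j; rewrite jacobianE; last first.
  exact: (smooth_differentiable (smooth_graph oU sf sg)).
have [c0 c1 c2 c3] := graph_coord f g.
rewrite mxE; have [->|->|->|->] := ord4P j => /=; rewrite ?c0 ?c1 ?c2 ?c3//;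
  exact: partial_coord.
Qed.

Lemma partial_comm U f u i j : open U -> smooth_on U f -> U u ->
  partial i (partial j f) u = partial j (partial i f) u.
Proof.
move=> oU sf Uu; apply: (derive_comm oU Uu) => [q Uq||].
- split; apply: diff_derivable; apply: smooth_differentiable Uq;
    by do ?[exact: sf | apply: smooth_derive].
- by apply: smooth_continuous Uu; do 2! apply: smooth_derive.
- by apply: smooth_continuous Uu; do 2! apply: smooth_derive.
Qed.

Lemma spacelike_graph U f g : open U -> smooth_on U f -> smooth_on U g ->
  spacelike_surface U (graph f g) <-> (forall u, U u -> 0 < Delta f g u).
Proof.
move=> oU sf sg; split=> [[_ sp] u Uu|D0].
  apply/(graph_tangents_spacelike (grad f u) (grad g u)).
  by have := sp u Uu; rewrite /tangent_plane (jacobian_graph oU sf sg).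
split; first split.
- exact: smooth_graph.
- move=> u Uu; rewrite (jacobian_graph oU sf sg)//.
  exact: graph_tangents_free.
- move=> u Uu; rewrite /tangent_plane (jacobian_graph oU sf sg)//.
  exact/(graph_tangents_spacelike (grad f u) (grad g u))/D0.
Qed.

Lemma product_rule_cancel (x y fj gj dx dy fij gij : R) :
  - x * fj + y * gj + ((dx * fij + fj * x) - (dy * gij + gj * y)) =
  dx * fij - dy * gij.
Proof. by ring. Qed.

Section Normals.
Context (U : set 'rV[R]_2) (f g : 'rV[R]_2 -> R).
Context (oU : open U) (sf : smooth_on U f) (sg : smooth_on U g).

Lemma sub_normal_plane_graph u (w : 'rV[R]_4) : U u ->
  (w <= normal_plane (graph f g) u)%MS <->
  w = graph_normal (grad f u) (grad g u) (w 0 0) (w 0 1).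
Proof.
move=> Uu; rewrite /normal_plane (jacobian_graph oU sf sg)//.
exact: sub_normal_graph.
Qed.

Lemma derivable_coord n (F : 'rV[R]_2 -> 'rV[R]_n) u j v :
  differentiable F u -> derivable (fun q => F q 0 j) u v.
Proof. by move=> /diff_derivable/derivable_mxP; apply. Qed.

(** Normality to X_j reads n_(2+j) = n_0 f_j - n_1 g_j on [U]; differentiating
    this identity, the terms with derivatives of [n] cancel. *)
Lemma second_fundamental_form (n : 'rV[R]_2 -> 'rV[R]_4) u i j :
  smooth_on U n ->
  (forall q, U q -> (n q <= normal_plane (graph f g) q)%MS) -> U u ->
  lorentz (row i ('J n u)) (row j (graph_tangents (grad f u) (grad g u))) =
  n u 0 0 * partial i (partial j f) u - n u 0 1 * partial i (partial j g) u.
Proof.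
move=> sn nn Uu; have dn := smooth_differentiable sn Uu.
have rowJ k : row i ('J n u) 0 k = partial i (fun q => n q 0 k) u.
  by rewrite mxE jacobianE.
rewrite lorentz_graph_tangents !rowJ.
set c := if _ then _ else _; pose e : 'rV[R]_2 := delta_mx 0 i.
pose n0 q := n q 0 0; pose n1 q := n q 0 1.
have nE q : U q -> (n0 * partial j f - n1 * partial j g) q = n q 0 c.
  move=> /[dup] Uq /nn /sub_normal_plane_graph nq.
  rewrite [in RHS](nq Uq) mxE /c.
  by have [->|->] := ord2P j.
have d0 : derivable n0 u e by exact: derivable_coord.
have d1 : derivable n1 u e by exact: derivable_coord.
have df : derivable (partial j f) u e.
  exact/diff_derivable/(smooth_differentiable (smooth_derive _ sf)).
have dg : derivable (partial j g) u e.
  exact/diff_derivable/(smooth_differentiable (smooth_derive _ sg)).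
have -> : partial i (fun q => n q 0 c) u =
    'D_e (n0 * partial j f - n1 * partial j g) u.
  exact/esym/near_eq_derive/(open_near_eq oU nE Uu).
rewrite (deriveB (derivableM d0 df) (derivableM d1 dg)).
rewrite (deriveM d0 df) (deriveM d1 dg).
exact: product_rule_cancel.
Qed.

Lemma trace_shape_operator (n : 'rV[R]_2 -> 'rV[R]_4) u :
  smooth_on U n ->
  (forall q, U q -> (n q <= normal_plane (graph f g) q)%MS) -> U u ->
  0 < Delta f g u ->
  Delta f g u * \tr (shape_operator (graph f g) n u) =
  - n u 0 0 * phi1 f g u + n u 0 1 * phi2 f g u.
Proof.
move=> sn nn Uu D0.
rewrite /shape_operator /tangent_proj /tangent_plane /normal_plane.
rewrite (jacobian_graph oU sf sg Uu).
apply: (shape_trace_graph (hf := fun i j => partial i (partial j f) u)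
  (hg := fun i j => partial i (partial j g) u)) => [i j|||].
- exact: second_fundamental_form.
- exact: partial_comm sf Uu.
- exact: partial_comm sg Uu.
- exact: D0.
Qed.

Lemma mean_curvature_graph nT nS u : normal_frame U (graph f g) nT nS -> U u ->
  0 < Delta f g u ->
  (mean_curvature_vector (graph f g) nT nS u = 0 <->
    phi1 f g u = 0 /\ phi2 f g u = 0) /\
  (is_isotropic (mean_curvature_vector (graph f g) nT nS u) <->
    trapping_form f g u = 0).
Proof.
move=> [sT sS frame] Uu D0.
have nT_normal q : U q -> (nT q <= normal_plane (graph f g) q)%MS.
  by move=> /frame[].
have nS_normal q : U q -> (nS q <= normal_plane (graph f g) q)%MS.
  by move=> /frame[].
have trT := trace_shape_operator sT nT_normal Uu D0.
have trS := trace_shape_operator sS nS_normal Uu D0.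
have [_ _ TT SS TS] := frame u Uu.
have /(sub_normal_plane_graph _ Uu) nTE := nT_normal u Uu.
have /(sub_normal_plane_graph _ Uu) nSE := nS_normal u Uu.
exact: (graph_normal_frame_comb nTE nSE TT SS TS trT trS).
Qed.

(** The frame has coordinates (s, s r^2 m) and (0, r) on (N1, N2), where al, - m
    and ga are the entries of the Gram matrix; see [gram_schmidt_coeffs]. *)
Lemma exists_normal_frame : (forall u, U u -> 0 < Delta f g u) ->
  exists nT nS, normal_frame U (graph f g) nT nS.
Proof.
move=> D0.
pose f1 := partial 0 f; pose f2 := partial 1 f.
pose g1 := partial 0 g; pose g2 := partial 1 g.
have [ef1 ef2] : smooth_expr U f1 /\ smooth_expr U f2.
  by split; apply: SmoothAtom; exact: smooth_derive.
have [eg1 eg2] : smooth_expr U g1 /\ smooth_expr U g2.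
  by split; apply: SmoothAtom; exact: smooth_derive.
pose m := f1 * g1 + f2 * g2.
pose ga := cst 1 + (g1 * g1 + g2 * g2).
have em : smooth_expr U m by apply: SmoothAdd; exact: SmoothMul.
have ega : smooth_expr U ga.
  by apply: SmoothAdd; [exact: SmoothCst|apply: SmoothAdd; exact: SmoothMul].
have ga0 u : 0 < ga u.
  by rewrite /ga /= ltr_pwDl// addr_ge0// -expr2 sqr_ge0.
pose r u := (Num.sqrt (ga u))^-1.
have er : smooth_expr U r by apply: SmoothRsqrt.
have rE u : r u * r u = (ga u)^-1.
  by rewrite -invfM -expr2 sqr_sqrtr// ltW.
pose al := cst (-1) + (f1 * f1 + f2 * f2).
have eal : smooth_expr U al.
  by apply: SmoothAdd; [exact: SmoothCst|apply: SmoothAdd; exact: SmoothMul].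
pose De := (m * m + cst (-1) * (ga * al)) * (r * r).
have eDe : smooth_expr U De.
  apply: SmoothMul; last exact: SmoothMul.
  apply: SmoothAdd; first exact: SmoothMul.
  by apply: SmoothMul; [exact: SmoothCst|exact: SmoothMul].
have mE u : m u = f1 u * g1 u + f2 u * g2 u by [].
have gaE u : ga u = 1 + g1 u ^+ 2 + g2 u ^+ 2.
  by rewrite -addrA !expr2.
have alE u : al u = -1 + f1 u ^+ 2 + f2 u ^+ 2.
  by rewrite -addrA !expr2.
have DeE u : De u = Delta f g u / ga u.
  rewrite -[LHS]/((m u * m u + -1 * (ga u * al u)) * (r u * r u)) rE.
  rewrite mE gaE alE; congr (_ / _).
  by rewrite /Delta -/f1 -/f2 -/g1 -/g2; ring.
have De0 u : U u -> 0 < De u by move=> Uu; rewrite DeE divr_gt0// D0.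
pose s u := (Num.sqrt (De u))^-1.
have es : smooth_expr U s by apply: SmoothRsqrt.
have sE u : U u -> s u * s u = (De u)^-1.
  by move=> Uu; rewrite -invfM -expr2 sqr_sqrtr// ltW// De0.
pose normal (x y : 'rV[R]_2 -> R) u :=
  graph_normal (grad f u) (grad g u) (x u) (y u).
have smooth_normal x y : smooth_expr U x -> smooth_expr U y ->
    smooth_on U (normal x y).
  move=> ex ey; apply: smooth_on_rV => // j; apply: smooth_expr_smooth => //.
  have [->|->|->|->] := ord4P j.
  - have -> // : (fun q => normal x y q 0 0) = x.
    by apply/funext => q; rewrite mxE.
  - have -> // : (fun q => normal x y q 0 1) = y.
    by apply/funext => q; rewrite mxE.
  - have -> : (fun q => normal x y q 0 2%:R) = x * f1 + cst (-1) * (y * g1).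
      by apply/funext => q; rewrite mxE /= mulN1r.
    apply: SmoothAdd; first exact: SmoothMul.
    by apply: SmoothMul; [exact: SmoothCst|exact: SmoothMul].
  - have -> : (fun q => normal x y q 0 3%:R) = x * f2 + cst (-1) * (y * g2).
      by apply/funext => q; rewrite mxE /= mulN1r.
    apply: SmoothAdd; first exact: SmoothMul.
    by apply: SmoothMul; [exact: SmoothCst|exact: SmoothMul].
have normalP x y u : U u -> (normal x y u <= normal_plane (graph f g) u)%MS.
  by move=> Uu; apply/(sub_normal_plane_graph _ Uu); rewrite !mxE.
exists (normal s (s * (r * (r * m)))), (normal (cst 0) r); split.
- by apply: smooth_normal => //; do 3! [apply: SmoothMul => //].
- by apply: smooth_normal => //; exact: SmoothCst.
move=> u Uu; have gan0 : ga u != 0 by rewrite gt_eqF.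
have ss := sE u Uu; have rr := rE u.
have Dn0 : Delta f g u != 0 by rewrite gt_eqF ?D0.
have DE : Delta f g u = m u ^+ 2 - ga u * al u by rewrite mE gaE alE.
rewrite DeE DE in ss; rewrite DE in Dn0.
have [Q1 Q2 Q3] := gram_schmidt_coeffs gan0 Dn0 rr ss.
rewrite alE gaE mE in Q1 Q2 Q3.
split; try exact: normalP; rewrite lorentz_graph_normal.
- exact: Q1.
- exact: Q2.
- exact: Q3.
Qed.

End Normals.
End GraphGeometry.

Theorem theorem6p1 (R : realType) (U : set 'rV[R]_2) (f g : 'rV[R]_2 -> R)
    (hU : domain U) (hf : smooth_on U f) (hg : smooth_on U g) :
  (strongly_marginally_trapped U (graph f g) <->
   forall u, U u -> [/\ 0 < Delta f g u, phi1 f g u = 0 & phi2 f g u = 0]) /\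
  (marginally_trapped U (graph f g) <->
   forall u, U u -> 0 < Delta f g u /\ trapping_form f g u = 0).
Proof.
have [oU _ _] := hU; have spE := spacelike_graph oU hf hg.
split; split.
- move=> [/spE D0 [[nT [nS nTS]] /(_ _ _ nTS) H]] u Uu.
  by have [[/(_ (H u Uu)) [p1 p2] _] _] :=
    mean_curvature_graph oU hf hg nTS Uu (D0 u Uu); split => //; exact: D0.
- move=> h; have D0 u : U u -> 0 < Delta f g u by move=> /h[].
  split; first exact/spE.
  split; first exact: exists_normal_frame.
  move=> nT nS nTS u Uu; have [_ p1 p2] := h u Uu.
  by apply/(mean_curvature_graph oU hf hg nTS Uu (D0 u Uu)).1.
- move=> [/spE D0 [[nT [nS nTS]] /(_ _ _ nTS) H]] u Uu; split; first exact: D0.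
  by apply/(mean_curvature_graph oU hf hg nTS Uu (D0 u Uu)).2; exact: H.
- move=> h; have D0 u : U u -> 0 < Delta f g u by move=> /h[].
  split; first exact/spE.
  split; first exact: exists_normal_frame.
  move=> nT nS nTS u Uu; have [_ p] := h u Uu.
  by apply/(mean_curvature_graph oU hf hg nTS Uu (D0 u Uu)).2.
Qed.
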